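(* Let $n\ge 1$ and let $\kappa\in\mathbb{R}_{>0}$ be a parameter. There exists a map $\mathrm{LK}^{\mathrm{B}}\colon \mathbb{R}_{>0}^{\mathsf{A}^n}\to\mathbb{R}_{>0}^{\mathsf{A}^n}$, each coordinate of which is given by a subtraction-free rational expression in $\kappa$ and the coordinates $\pi([i,j])$ of the input $\pi$, such that: (1) $\mathrm{LK}^{\mathrm{B}}$ is an involution; (2) for every $\pi\in\mathbb{R}_{>0}^{\mathsf{A}^n}$, $$\prod_{[i,j]\in\mathsf{A}^n}\pi([i,j])\cdot\prod_{[i,j]\in\mathsf{A}^n}\mathrm{LK}^{\mathrm{B}}(\pi)([i,j])=\kappa^{n},\qquad \prod_{[i,j]\in\mathsf{A}^n}\pi([i,j])^{i+j}\cdot\prod_{[i,j]\in\mathsf{A}^n}\mathrm{LK}^{\mathrm{B}}(\pi)([i,j])^{i+j}=\kappa^{n(n+1)};$$ (3) its tropicalization is a piecewise-linear map $\mathrm{LK}^{\mathrm{PL}}\colon\mathbb{R}^{\mathsf{A}^n}\to\mathbb{R}^{\mathsf{A}^n}$, which maps the chain polytope $\mathcal{C}(\mathsf{A}^n)$ into itself, and whose restriction to the vertices of $\mathcal{C}(\mathsf{A}^n)$ (identified with antichains of $\mathsf{A}^n$ via indicator functions) is the Lalanne--Kreweras involution $\mathrm{LK}\colon\mathcal{A}(\mathsf{A}^n)\to\mathcal{A}(\mathsf{A}^n)$.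
   Context: $\mathsf{A}^n$ is the poset of nonempty intervals $[i,j]=\{i,\dots,j\}\subseteq\{1,\dots,n\}$, $1\le i\le j\le n$, ordered by inclusion. $\mathcal{A}(\mathsf{A}^n)$ is its set of antichains. A set $A=\{[i_1,j_1],\dots,[i_k,j_k]\}$ with $i_1<\dots<i_k$ is an antichain iff also $j_1<\dots<j_k$ (and $i_\ell\le j_\ell$). The Lalanne--Kreweras involution sends such $A$ to $\mathrm{LK}(A)=\{[i'_1,j'_1],\dots,[i'_m,j'_m]\}$ where $\{i'_1<\dots<i'_m\}=\{1,\dots,n\}\setminus\{j_1,\dots,j_k\}$ and $\{j'_1<\dots<j'_m\}=\{1,\dots,n\}\setminus\{i_1,\dots,i_k\}$. The chain polytope $\mathcal{C}(\mathsf{A}^n)\subseteq\mathbb{R}^{\mathsf{A}^n}$ is the set of $\pi$ with $0\le\sum_{x\in C}\pi(x)\le 1$ for every chain $C$; its vertices are the indicator functions of antichains. The tropicalization of a subtraction-free rational expression is obtained by replacing $+$ by $\max$, multiplication by $+$, division by subtraction, the multiplicative constant $1$ by $0$, and the parameter $\kappa$ by the constant $1$. *)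

(* Defs.v *)
From HB Require Import structures.
From mathcomp Require Import all_boot all_order all_algebra.
From mathcomp Require Import reals.

Set Implicit Arguments.
Unset Strict Implicit.
Unset Printing Implicit Defensive.

Import Order.TTheory GRing.Theory Num.Theory.

(* The interval [i, j] of {1, ..., n} is stored with endpoints shifted to
   'I_n = {0, ..., n - 1}; [lo] and [hi] return the endpoints in {1, ..., n}. *)
Record ivl (n : nat) := Ivl {
  ends : 'I_n * 'I_n;
  _ : (ends.1 <= ends.2)%N
}.
HB.instance Definition _ n := [isSub for @ends n].
HB.instance Definition _ n := [Finite of ivl n by <:].

Definition lo n (x : ivl n) : nat := (ends x).1.+1.
Definition hi n (x : ivl n) : nat := (ends x).2.+1.

Definition elements n (x : ivl n) : {set 'I_n} :=
  [set k : 'I_n | (lo x <= k.+1 <= hi x)%N].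

Lemma lo_le_hi n (x : ivl n) : (lo x <= hi x)%N.
Proof. by case: x. Qed.

Lemma elements_subsetE n (x y : ivl n) :
  (elements x \subset elements y) = (lo y <= lo x)%N && (hi x <= hi y)%N.
Proof.
have xlh := lo_le_hi x; apply/subsetP/andP => [sub | [yx xy] k]; last first.
  rewrite !inE => /andP[xk kx].
  by rewrite (leq_trans yx xk) (leq_trans kx xy).
have /sub : (ends x).1 \in elements x by rewrite inE leqnn.
have /sub : (ends x).2 \in elements x by rewrite inE leqnn andbT.
by rewrite !inE => /andP[_ ->] /andP[-> _].
Qed.

Lemma ivl_inj n (x y : ivl n) : lo x = lo y -> hi x = hi y -> x = y.
Proof.
move=> [lxy] [hxy]; apply: val_inj => /=.
by apply/eqP; rewrite -pair_eqE /= -!val_eqE /= lxy hxy !eqxx.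
Qed.

Definition ivl_le n (x y : ivl n) : bool := elements x \subset elements y.

Fact ivl_le_refl n : reflexive (@ivl_le n).
Proof. by move=> x; apply: subxx. Qed.

Fact ivl_le_anti n : antisymmetric (@ivl_le n).
Proof.
move=> x y; rewrite /ivl_le !elements_subsetE.
case/andP=> /andP[yx xy] /andP[xy' yx'].
by apply: ivl_inj; apply/eqP; rewrite eqn_leq ?yx ?xy ?xy' ?yx'.
Qed.

Fact ivl_le_trans n : transitive (@ivl_le n).
Proof. by move=> y x z; apply: subset_trans. Qed.

Fact ivl_display : Order.disp_t. Proof. exact: Order.Disp tt tt. Qed.

HB.instance Definition _ n := Order.Le_isPOrder.Build ivl_display (ivl n)
  (@ivl_le_refl n) (@ivl_le_anti n) (@ivl_le_trans n).

Definition chain n (C : {set ivl n}) : Prop :=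
  {in C &, forall x y, (x >=< y)%O}.

Definition antichain n (A : {set ivl n}) : Prop :=
  {in A &, forall x y, (x <= y)%O -> x = y}.

(* {1, ..., n} minus the right (resp. left) endpoints of A, in increasing
   order. *)
Definition new_los n (A : {set ivl n}) : seq nat :=
  [seq k <- iota 1 n | k \notin [seq hi x | x in A]].
Definition new_his n (A : {set ivl n}) : seq nat :=
  [seq k <- iota 1 n | k \notin [seq lo x | x in A]].

(* On antichains the two sequences have the same size and every pair (i', j')
   satisfies i' <= j' ([size_new_los_his], [new_los_le_his]), so no pair is
   lost in passing to a set of intervals; the result is again an antichain
   ([LK_antichain]). *)
Definition LK n (A : {set ivl n}) : {set ivl n} :=
  [set x | (lo x, hi x) \in zip (new_los A) (new_his A)].

Lemma antichain_lo_inj n (A : {set ivl n}) : antichain A -> {in A &, injective (@lo n)}.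
Proof.
move=> anti x y xA yA lxy; have [le|/ltnW le] := leqP (hi x) (hi y).
  by apply: anti => //; rewrite /Order.le /= /ivl_le elements_subsetE lxy leqnn.
by symmetry; apply: anti => //; rewrite /Order.le /= /ivl_le elements_subsetE lxy leqnn.
Qed.

Lemma antichain_hi_inj n (A : {set ivl n}) : antichain A -> {in A &, injective (@hi n)}.
Proof.
move=> anti x y xA yA hxy; have [le|/ltnW le] := leqP (lo x) (lo y).
  by symmetry; apply: anti => //; rewrite /Order.le /= /ivl_le elements_subsetE hxy leqnn le.
by apply: anti => //; rewrite /Order.le /= /ivl_le elements_subsetE hxy leqnn le.
Qed.

(* Counting the entries at most k of the complement in {1, ..., n} of the
   values of an injective f : A -> {1, ..., n}. *)
Lemma count_compl n (A : {set ivl n}) (f : ivl n -> nat) k :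
    {in A &, injective f} -> (forall x, 0 < f x <= n)%N ->
  (count (leq^~ k) [seq i <- iota 1 n | i \notin [seq f x | x in A]]
   + count (fun x => f x <= k) (enum A) = count (leq^~ k) (iota 1 n))%N.
Proof.
move=> finj fn; set s := [seq f x | x in A].
have us : uniq s by rewrite map_inj_in_uniq ?enum_uniq // => x y; rewrite !mem_enum; apply: finj.
have -> : count (fun x => f x <= k) (enum A) = count (leq^~ k) s by rewrite count_map.
have -> : count (leq^~ k) s = count (leq^~ k) [seq i <- iota 1 n | i \in s].
  apply/permP; apply: uniq_perm; rewrite ?filter_uniq ?iota_uniq // => i.
  rewrite mem_filter mem_iota add1n ltnS; case: (boolP (i \in s)) => //= /mapP[x _ ->].
  by rewrite fn.
by rewrite addnC -count_cat; apply/permP; rewrite perm_filterC.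
Qed.

Lemma lo_bounds n (x : ivl n) : (0 < lo x <= n)%N.
Proof. exact: ltn_ord. Qed.

Lemma hi_bounds n (x : ivl n) : (0 < hi x <= n)%N.
Proof. exact: ltn_ord. Qed.

Lemma size_new_los_his n (A : {set ivl n}) :
  antichain A -> size (new_los A) = size (new_his A).
Proof.
move=> anti.
have cnt (s : pred nat) :
    count (leq^~ n) [seq i <- iota 1 n | s i] = size [seq i <- iota 1 n | s i].
  apply/eqP; rewrite -all_count; apply/allP => i.
  by rewrite mem_filter mem_iota add1n ltnS => /and3P[].
have := count_compl n (antichain_lo_inj anti) (@lo_bounds n).
rewrite -(count_compl n (antichain_hi_inj anti) (@hi_bounds n)).
rewrite !cnt.
have -> : count (fun x : ivl n => lo x <= n)%N (enum A) = size (enum A).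
  by apply/eqP; rewrite -all_count; apply/allP => x _; case/andP: (lo_bounds x).
have -> : count (fun x : ivl n => hi x <= n)%N (enum A) = size (enum A).
  by apply/eqP; rewrite -all_count; apply/allP => x _; case/andP: (hi_bounds x).
by move/addIn.
Qed.

Lemma count_sorted_nth (s : seq nat) l k : sorted ltn s -> (l < size s)%N ->
  (l < count (leq^~ k) s)%N = (nth 0%N s l <= k)%N.
Proof.
elim: s l => //= a s IHs l pas ls.
have as_ := order_path_min ltn_trans pas.
have [ak|ka] := leqP a k; last first.
  rewrite add0n; have -> : count (leq^~ k) s = 0%N.
    apply/eqP; rewrite -leqn0 leqNgt -has_count; apply/hasPn => b /(allP as_) /= ab.
    by rewrite -ltnNge (ltn_trans ka).
  rewrite ltn0; apply/esym/negbTE; rewrite -ltnNge.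
  case: l ls => //= l ls; apply: (ltn_trans ka).
  by apply: (allP as_); apply: mem_nth.
case: l ls => [|l] ls /=; first by rewrite add1n ak.
by rewrite add1n ltnS IHs // (path_sorted pas).
Qed.

Lemma new_los_le_his n (A : {set ivl n}) l : antichain A ->
  (l < size (new_los A))%N -> (nth 0 (new_los A) l <= nth 0 (new_his A) l)%N.
Proof.
move=> anti ll; have lh := ll; rewrite size_new_los_his // in lh.
have srt (s : pred nat) : sorted ltn [seq i <- iota 1 n | s i].
  by apply: sorted_filter; [exact: ltn_trans | exact: iota_ltn_sorted].
rewrite -count_sorted_nth //; last exact: srt.
set k := nth _ _ _; have : (l < count (leq^~ k) (new_his A))%N.
  by rewrite count_sorted_nth //; exact: srt.
move=> /leq_trans; apply.
have := count_compl k (antichain_lo_inj anti) (@lo_bounds n).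
rewrite -(count_compl k (antichain_hi_inj anti) (@hi_bounds n)) => eqc.
have le : (count (fun x => hi x <= k) (enum A) <= count (fun x => lo x <= k) (enum A))%N.
  by apply: sub_count => x /=; apply: leq_trans; exact: lo_le_hi.
by rewrite -(leq_add2r (count (fun x => hi x <= k) (enum A))) -eqc leq_add2l.
Qed.

Lemma LK_antichain n (A : {set ivl n}) : antichain A -> antichain (LK A).
Proof.
move=> anti x y; rewrite !inE.
have szE := size_new_los_his anti.
have srt (s : pred nat) : sorted ltn [seq i <- iota 1 n | s i].
  by apply: sorted_filter; [exact: ltn_trans | exact: iota_ltn_sorted].
have le_nth s : sorted ltn s -> {in [pred i | i < size s]%N &,
    forall a b, (nth 0 s a <= nth 0 s b)%N = (a <= b)%N}.
  move=> ss a b la lb; apply: (leq_mono_in (sorted_ltn_nth ltn_trans 0%N ss)) => //.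
move=> /(nthP (0, 0)%N)[a la]; rewrite nth_zip // => -[lx hx].
move=> /(nthP (0, 0)%N)[b lb]; rewrite nth_zip // => -[ly hy].
move: la lb; rewrite size1_zip ?szE // => la lb.
rewrite /Order.le /= /ivl_le elements_subsetE -lx -ly -hx -hy.
rewrite !le_nth ?inE ?szE //; [|exact: srt|exact: srt].
rewrite -eqn_leq => /eqP ba.
by apply: ivl_inj; rewrite -?lx -?ly -?hx -?hy ba.
Qed.

Local Open Scope ring_scope.

(* Subtraction-free rational expressions in the parameter kappa and variables
   indexed by X. *)
Inductive sfexpr (X : Type) : Type :=
  | SFVar of X
  | SFKappa
  | SFOne
  | SFAdd of sfexpr X & sfexpr X
  | SFMul of sfexpr X & sfexpr X
  | SFDiv of sfexpr X & sfexpr X.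
Arguments SFKappa {X}.
Arguments SFOne {X}.

Fixpoint sfeval (R : realType) (X : Type) (kappa : R) (p : X -> R)
    (e : sfexpr X) : R :=
  match e with
  | SFVar x => p x
  | SFKappa => kappa
  | SFOne => 1
  | SFAdd e1 e2 => sfeval kappa p e1 + sfeval kappa p e2
  | SFMul e1 e2 => sfeval kappa p e1 * sfeval kappa p e2
  | SFDiv e1 e2 => sfeval kappa p e1 / sfeval kappa p e2
  end.

Fixpoint tropeval (R : realType) (X : Type) (p : X -> R) (e : sfexpr X) : R :=
  match e with
  | SFVar x => p x
  | SFKappa => 1
  | SFOne => 0
  | SFAdd e1 e2 => Num.max (tropeval p e1) (tropeval p e2)
  | SFMul e1 e2 => tropeval p e1 + tropeval p e2
  | SFDiv e1 e2 => tropeval p e1 - tropeval p e2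
  end.

Definition birational_map (R : realType) (X : finType) (E : X -> sfexpr X)
    (kappa : R) (p : {ffun X -> R}) : {ffun X -> R} :=
  [ffun x => sfeval kappa p (E x)].

Definition tropicalization (R : realType) (X : finType) (E : X -> sfexpr X)
    (p : {ffun X -> R}) : {ffun X -> R} :=
  [ffun x => tropeval p (E x)].

Definition positive (R : realType) (X : finType) (p : {ffun X -> R}) : Prop :=
  forall x, 0 < p x.

(* The pair (a, b) encodes the affine form p |-> b + \sum_x a x * p x. *)
Definition affine_form (R : realType) (X : finType) : Type :=
  ({ffun X -> R} * R)%type.

Definition aeval (R : realType) (X : finType) (l : affine_form R X)
    (p : {ffun X -> R}) : R :=
  l.2 + \sum_(x : X) l.1 x * p x.

Definition polyhedron (R : realType) (X : finType)
    (hs : seq (affine_form R X)) (p : {ffun X -> R}) : Prop :=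
  forall h, h \in hs -> 0 <= aeval h p.

(* Since kappa tropicalizes to the constant 1, "piecewise-linear" allows affine
   pieces. Continuity is automatic: finitely many closed cells cover R^X. *)
Definition piecewise_linear (R : realType) (X Y : finType)
    (f : {ffun X -> R} -> {ffun Y -> R}) : Prop :=
  exists (N : nat) (cell : 'I_N -> seq (affine_form R X))
         (piece : 'I_N -> Y -> affine_form R X),
    (forall p, exists k, polyhedron (cell k) p) /\
    (forall k p, polyhedron (cell k) p ->
       forall y, f p y = aeval (piece k y) p).

Definition chain_polytope (R : realType) n (p : {ffun ivl n -> R}) : Prop :=
  forall C : {set ivl n}, chain C -> 0 <= \sum_(x in C) p x <= 1.

Definition indicator (R : realType) n (A : {set ivl n}) : {ffun ivl n -> R} :=
  [ffun x => (x \in A)%:R].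

(* Main.v *)
Require Import Defs.
From mathcomp Require Import all_boot all_order all_algebra.
From mathcomp Require Import reals sequences exp.
From mathcomp Require Import zify ring lra.
Import Order.TTheory GRing.Theory Num.Theory.
Local Open Scope ring_scope.

Set Implicit Arguments.
Unset Strict Implicit.
Unset Printing Implicit Defensive.

(* In logarithmic coordinates both the birational map and its tropicalization
   are the same map over R with an operation [op] (log-sum-exp or max) such that
   op (a + c) (b + c) = op a b + c. Let e_0(x) be the op-sum, over maximal chains
   going up from x, of the sums of p. Toggling t times gives arrays e_t with
     e_{t+1}(x) + e_t(x) = op-sum of e_{t+1} over the upper covers of x
                           - op-sum of -e_t over the lower covers of x.
   For x of rank k the image of p is q(x) = e_{k-1}(x) - (op-sum of e_k over the
   upper covers of x), and K - e_0(x) when k = 0. The recursion is invariant under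
   time reversal: the arrays of q are e'_t(x) = e_{k-1-t}(x), so the map is an
   involution. Lozenge by lozenge, the recursion telescopes along rows and columns
   to show that the p-sum over the intervals with left (right) end i plus the q-sum
   over the intervals with right (left) end i is K; this gives both product
   formulas. Tropically, e_0(x) is the maximal chain sum above x; monotonicity of e
   gives q >= 0, and e'_0([i,i]) = 1 - p([i,i]) bounds the chain sums of q. Integral
   points of the chain polytope are indicators of antichains, and the row and
   column identities then determine the end points of the image antichain. *)

(* Intervals are pairs i <= j < n, so the upper covers of (i, j) are (i - 1, j) and
   (i, j + 1); the top (0, n - 1) has none. *)
Definition upsum (T : Type) (o : T) (add : T -> T -> T) (n : nat)
    (f : nat -> nat -> T) (i j : nat) : T :=
  if i is i'.+1
  then if (j.+1 < n)%N then add (f i' j) (f i j.+1) else f i' j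
  else if (j.+1 < n)%N then f i j.+1 else o.

Arguments upsum : simpl never.

Lemma eq_upsum (T : Type) (o : T) add n f g i j :
    (forall i', i = i'.+1 -> f i' j = g i' j) ->
    ((j.+1 < n)%N -> f i j.+1 = g i j.+1) ->
  upsum o add n f i j = upsum o add n g i j.
Proof.
rewrite /upsum; case: i => [|i] fg1 fg2; case: ifP => // jn.
all: by rewrite ?fg1 ?fg2.
Qed.

(** Both upper covers lengthen the interval, so this is induction on n - (j - i). *)
Lemma upper_ind n (P : nat -> nat -> Prop) :
    (forall i j, (i <= j < n)%N -> (forall i', i = i'.+1 -> P i' j) ->
      ((j.+1 < n)%N -> P i j.+1) -> P i j) ->
  forall i j, (i <= j < n)%N -> P i j.
Proof.
move=> IH i j; have [m] := ubnP (n - (j - i))%N.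
elim: m i j => // m IHm i j lem ij; apply: IH => // [i' ii'|jn]; apply: IHm; lia.
Qed.

Lemma big_nat_predr (V : zmodType) (F : nat -> V) a b : (a < b)%N ->
  \sum_(a <= k < b) F k = \sum_(a <= k < b.-1) F k + F b.-1.
Proof. by case: b => // b; rewrite ltnS => le_ab; rewrite big_nat_recr. Qed.

(** * The toggle evolution and its time reversal *)

(** The bound t < j - i keeps the lower covers, of rank j - i - 1, at rank at least t. Subtracting
    [op] of negated values adds the dual operation, which is min when [op] is max. *)
Record evolution (R : realType) (op : R -> R -> R) (n : nat)
    (p : nat -> nat -> R) (e : nat -> nat -> nat -> R) : Prop := Evolution {
  evol0 : forall i j, (i <= j < n)%N ->
    e 0%N i j = p i j + upsum 0 op n (e 0%N) i j;
  evolS : forall t i j, (i <= j < n)%N -> (t < j - i)%N ->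
    e t.+1 i j = upsum 0 op n (e t.+1) i j - e t i j
                 - op (- e t i.+1 j) (- e t i j.-1)
}.

(* [(j - i).-1] is only read for i < j, so the truncation is harmless. *)
Definition readout (R : realType) (op : R -> R -> R) (K : R) (n : nat)
    (e : nat -> nat -> nat -> R) (i j : nat) : R :=
  if i == j then K - e 0%N i j
  else e (j - i).-1 i j - upsum 0 op n (e (j - i)%N) i j.

Section Evolution.
Variables (R : realType) (op : R -> R -> R) (K : R) (n : nat).
Hypothesis opD : forall a b c, op (a + c) (b + c) = op a b + c.
Local Notation up := (upsum 0 op n).

Lemma op_opp a b : op (- a) (- b) = op b a - a - b.
Proof. by rewrite -!addrA -opD; congr (op _ _); ring. Qed.

(* The lower covers of (i, j + 1) are the upper covers of (i + 1, j). *)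
Lemma evolution_diag p e : evolution op n p e ->
  forall t i j, (i.+1 <= j)%N -> (j.+1 < n)%N -> (t <= j - i)%N ->
  up (e t.+1) i j.+1 + e t i j + e t i.+1 j.+1 =
  e t.+1 i j.+1 + e t i j.+1 + up (e t) i.+1 j.
Proof.
move=> E t i j ij jn tji; rewrite (@evolS _ _ _ _ _ E t i j.+1); [|lia|lia].
by rewrite op_opp [up (e t) i.+1 j]/upsum jn /=; ring.
Qed.

(** Write k = j - i. At time 0, [readout] is exactly the increment that makes e'_0 = e_(k-1), since
    the upper covers have rank k + 1 and carry e_k. Later times follow because [evolS] is symmetric
    in the values at (i, j) at times s and s + 1; reversal exchanges them for s = k - t - 2 and
    matches the values at the covers. *)
Lemma evolution_readout p q e e' : evolution op n p e ->
    evolution op n q e' ->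
    (forall i j, (i <= j < n)%N -> q i j = readout op K n e i j) ->
  forall t i j, (i <= j < n)%N -> (t < j - i)%N ->
  e' t i j = e (j - i - t.+1)%N i j.
Proof.
move=> E E' qE; elim=> [|t IHt] i j ijn.
  move: i j ijn; apply: upper_ind => i j ijn IHi IHj ltij.
  rewrite (evol0 E') // qE // /readout ifF; last lia.
  have -> : (j - i - 1)%N = (j - i).-1 by lia.
  rewrite -[RHS](subrK (up (e (j - i)%N) i j)); congr (_ + _).
  apply: eq_upsum => [i' ii'|jn].
    by rewrite IHi //; [congr (e _ _ _)|]; lia.
  by rewrite IHj //; [congr (e _ _ _)|]; lia.
move: i j ijn; apply: upper_ind => i j ijn IHi IHj ltij.
rewrite (evolS E') //; last lia.
rewrite !IHt; [|lia..].
have := @evolS _ _ _ _ _ E (j - i - t.+2)%N i j ijn.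
have -> : (j - i - t.+1)%N = (j - i - t.+2).+1 by lia.
have -> : (j - i.+1 - t.+1)%N = (j - i - t.+2)%N by lia.
have -> : (j.-1 - i - t.+1)%N = (j - i - t.+2)%N by lia.
move=> ->; last lia.
have -> : up (e' t.+1) i j = up (e (j - i - t.+2).+1) i j; last by ring.
apply: eq_upsum => [i' ii'|jn].
  by rewrite IHi //; [congr (e _ _ _)|]; lia.
by rewrite IHj //; [congr (e _ _ _)|]; lia.
Qed.

(** The upper covers of (i, i) have rank 1, where e'_0 = e_0, so the two [up] terms cancel. *)
Lemma evolution_readout_diag p q e e' : evolution op n p e ->
    evolution op n q e' ->
    (forall i j, (i <= j < n)%N -> q i j = readout op K n e i j) ->
  forall i, (i < n)%N -> e' 0%N i i = K - p i i.
Proof.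
move=> E E' qE i ltin.
rewrite (evol0 E') ?leqnn // qE ?leqnn // /readout eqxx.
rewrite (evol0 E) ?leqnn //.
have -> : up (e' 0%N) i i = up (e 0%N) i i; last by ring.
apply: eq_upsum => [i' ii'|jn]; rewrite (evolution_readout E E' qE) //;
  by [congr (e _ _ _); lia|lia].
Qed.

(** At rank k > 0, reversal turns e'_(k-1) at the point and e'_k at its upper covers into e_0, and
    [evol0] leaves p. *)
Lemma readoutK p q e e' : evolution op n p e -> evolution op n q e' ->
    (forall i j, (i <= j < n)%N -> q i j = readout op K n e i j) ->
  forall i j, (i <= j < n)%N -> readout op K n e' i j = p i j.
Proof.
move=> E E' qE i j ijn; rewrite {1}/readout; case: eqP => [<-|/eqP neij].
  by rewrite (evolution_readout_diag E E' qE) //; [ring|lia].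
rewrite (evolution_readout E E' qE) //; [|lia].
have -> : (j - i - (j - i).-1.+1)%N = 0%N by lia.
rewrite (evol0 E) //.
have -> : up (e' (j - i)%N) i j = up (e 0%N) i j; last by ring.
apply: eq_upsum => [i' ii'|jn]; rewrite (evolution_readout E E' qE) //;
  by [congr (e _ _ _); lia|lia].
Qed.

(** * Row and column sums *)

(** For f = e_0 the summand is p; later times appear when a sum is moved to a neighbouring row or
    column. *)
Definition rowsum (f : nat -> nat -> R) i a : R :=
  \sum_(a <= m < n) (f i m - up f i m).
Definition colsum (f : nat -> nat -> R) j b : R :=
  \sum_(0 <= m < b.+1) (f m j - up f m j).

(** In row 0 the only upper cover is the right neighbour, so the sum telescopes; at the top [upsum]
    is 0. *)
Lemma rowsum_top f a : (a < n)%N -> rowsum f 0 a = f 0%N a.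
Proof.
move=> ltan; rewrite /rowsum.
have upE k : (k < n)%N -> up f 0 k = if (k.+1 < n)%N then f 0%N k.+1 else 0.
  by rewrite /upsum.
have -> : \sum_(a <= k < n) (f 0%N k - up f 0 k) =
          \sum_(a <= k < n.-1) (f 0%N k - f 0%N k.+1) + f 0%N n.-1.
  rewrite big_nat_predr //.
  rewrite upE ?ifF; [|lia..]; rewrite subr0; congr (_ + _).
  by apply: eq_big_nat => k kb; rewrite upE ?ifT //; lia.
rewrite -[LHS](opprK) opprD -sumrN; under eq_bigr do rewrite opprB.
by rewrite telescope_sumr; [ring|lia].
Qed.

(** The hypothesis is [evolution_diag] with f = e_t and g = e_(t+1). Summed along the row, its
    remaining terms telescope; the cell in the last column is split off, its only upper cover being
    (i, n - 1). *)
Lemma rowsum_step f g i a : (a < n)%N ->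
    (forall j, (a <= j)%N -> (j.+1 < n)%N ->
      up g i j.+1 + f i j + f i.+1 j.+1 = g i j.+1 + f i j.+1 + up f i.+1 j) ->
  rowsum f i.+1 a = rowsum g i a.+1 + f i.+1 a - f i a.
Proof.
move=> ltan fg; rewrite /rowsum big_add1 big_nat_predr //.
have -> : up f i.+1 n.-1 = f i n.-1 by rewrite /upsum ifF //; lia.
have -> : \sum_(a <= k < n.-1) (f i.+1 k - up f i.+1 k) =
    \sum_(a <= k < n.-1) (g i k.+1 - up g i k.+1) +
    \sum_(a <= k < n.-1) (f i k.+1 - f i k) -
    \sum_(a <= k < n.-1) (f i.+1 k.+1 - f i.+1 k).
  rewrite -sumrN -!big_split; apply: eq_big_nat => k /= kb.
  have [ak kn] : (a <= k)%N /\ (k.+1 < n)%N by lia.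
  by have := fg k ak kn; lra.
rewrite !telescope_sumr; [|lia..].
by ring.
Qed.

Lemma colsum_last f b : (b < n)%N -> colsum f n.-1 b = f b n.-1.
Proof.
move=> ltbn; have upE k : up f k n.-1 = if k is k'.+1 then f k' n.-1 else 0.
  by case: k => [|k]; rewrite /upsum ifF //; lia.
elim: b ltbn => [|b IHb] ltbn; first by rewrite /colsum big_nat1 upE subr0.
by rewrite /colsum big_nat_recr //= -/(colsum f _ b) IHb ?upE; [ring|lia].
Qed.

(** Transpose of [rowsum_step], with the cell in row 0 split off. *)
Lemma colsum_step f g j b : (j.+1 < n)%N ->
    (forall i, (i <= b)%N ->
      up g i j.+1 + f i j + f i.+1 j.+1 = g i j.+1 + f i j.+1 + up f i.+1 j) ->
  colsum f j b.+1 = colsum g j.+1 b + f b.+1 j - f b.+1 j.+1.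
Proof.
move=> jn fg; rewrite /colsum big_nat_recl //.
have -> : up f 0%N j = f 0%N j.+1 by rewrite /upsum jn.
have -> : \sum_(0 <= i < b.+1) (f i.+1 j - up f i.+1 j) =
    \sum_(0 <= i < b.+1) (g i j.+1 - up g i j.+1) +
    \sum_(0 <= i < b.+1) (f i.+1 j - f i j) -
    \sum_(0 <= i < b.+1) (f i.+1 j.+1 - f i j.+1).
  rewrite -sumrN -!big_split; apply: eq_big_nat => i /= ib.
  by have := fg i ib; lra.
by rewrite !(telescope_sumr (fun i => f i _)) //; ring.
Qed.

(** With j = i + 2d the rank of (i, j) is 2d, and around it time d of e meets time d of e' under
    reversal. Each induction step replaces (i + 1, j, d) by (i, j + 1, d + 1), trading column j for
    j + 1 and row i + 1 for i, until row 0 or the last column is reached. *)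
Lemma colsum_rowsum p q e e' : evolution op n p e -> evolution op n q e' ->
    (forall i j, (i <= j < n)%N -> q i j = readout op K n e i j) ->
  forall i j d, j = (i + d.*2)%N -> (j < n)%N ->
  colsum (e d) j i + rowsum (e' d) i j = e d i j + e' d i j - up (e d) i j.
Proof.
move=> E E' qE; elim=> [|i IHi] j d jE jn.
  by rewrite rowsum_top // /colsum big_nat1; ring.
(* Here (i, j) has rank 2d + 1, and the reversal t -> 2d - t fixes d. *)
have e'E : e' d i j = e d i j.
  by rewrite (evolution_readout E E' qE); [congr (e _ _ _)|..]; lia.
have [jn1|] := ltnP j.+1 n; last first.
  (* In the last column the row sum has a single term and the column sum telescopes. *)
  move=> nj; have {nj} jE' : j = n.-1 by lia.
  have -> : rowsum (e' d) i.+1 j = e' d i.+1 j - e' d i j.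
    rewrite /rowsum jE' big_nat_predr; last lia.
    by rewrite big_geq // add0r /upsum ifF //; lia.
  by rewrite e'E jE' colsum_last -?jE' /upsum ?ifF; [ring|lia..].
rewrite (rowsum_step (g := e' d.+1)) //; last first.
  by move=> k jk kn; apply: (evolution_diag E'); lia.
rewrite (colsum_step (g := e d.+1)) //; last first.
  by move=> k ki; apply: (evolution_diag E); lia.
have := IHi j.+1 d.+1.
have -> : e' d.+1 i j.+1 = e d i j.+1.
  by rewrite (evolution_readout E E' qE); [congr (e _ _ _)|..]; lia.
have := @evolution_diag _ _ E d i j.
rewrite e'E => diag IH.
have {}diag := diag ltac:(lia) ltac:(lia) ltac:(lia).
have {}IH := IH ltac:(lia) ltac:(lia).
lra.
Qed.

(** The case d = 0: the right-hand side is e_0(i, i) + (K - p(i, i)) minus the [up] term, which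
    [evol0] reduces to K. *)
Lemma col_row_readout p q e e' : evolution op n p e -> evolution op n q e' ->
    (forall i j, (i <= j < n)%N -> q i j = readout op K n e i j) ->
  forall i, (i < n)%N ->
  \sum_(0 <= m < i.+1) p m i + \sum_(i <= m < n) q i m = K.
Proof.
move=> E E' qE i ltin.
have -> : \sum_(0 <= m < i.+1) p m i = colsum (e 0%N) i i.
  by apply: eq_big_nat => m mi; rewrite (evol0 E); [ring|lia].
have -> : \sum_(i <= m < n) q i m = rowsum (e' 0%N) i i.
  by apply: eq_big_nat => m mi; rewrite (evol0 E'); [ring|lia].
rewrite (colsum_rowsum E E' qE) ?addn0 // (evolution_readout_diag E E' qE) //.
by rewrite (evol0 E) ?leqnn //; ring.
Qed.

End Evolution.

(** * Monotonicity in the tropical case *)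

Section Tropical.
Variables (R : realType) (n : nat).
Local Notation up := (upsum (0 : R) Num.max n).

(** The last hypothesis covers the top, where [upsum] takes its default 0. *)
Lemma upsum_le f i j c : (i <= j < n)%N ->
    (forall i', i = i'.+1 -> f i' j <= c) -> ((j.+1 < n)%N -> f i j.+1 <= c) ->
    (i = 0%N -> j = n.-1 -> 0 <= c) ->
  up f i j <= c.
Proof.
move=> ijn fi fj f0; rewrite /upsum; case: i fi fj f0 ijn => [|i] fi fj f0 ijn.
  by case: ifP => [|jn]; [apply: fj | apply: f0; lia].
by case: ifP => [jn|_]; rewrite ?ge_max ?fi ?fj.
Qed.

Lemma upsum_ge_left f i j : f i j <= up f i.+1 j.
Proof. by rewrite /upsum; case: ifP => // _; rewrite le_max lexx. Qed.

Lemma upsum_ge_right f i j : (j.+1 < n)%N -> f i j.+1 <= up f i j.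
Proof. by move=> jn; rewrite /upsum jn; case: i => // i; rewrite le_max lexx orbT. Qed.

Variables (p : nat -> nat -> R) (e : nat -> nat -> nat -> R).
Hypothesis E : evolution Num.max n p e.
Hypothesis p_ge0 : forall i j, (i <= j < n)%N -> 0 <= p i j.

(** By [evolS], e_(t+1) exceeds its [up] by the minimum of e_t over the lower covers minus e_t at
    the point. This is nonnegative by induction on t, the point being an upper cover of each of
    them. *)
Lemma upsum_evolution_le t i j : (i <= j < n)%N -> (t <= j - i)%N ->
  up (e t) i j <= e t i j.
Proof.
elim: t i j => [|t IHt] i j ijn tji.
  by rewrite (evol0 E) // lerDr p_ge0.
rewrite (evolS E) // -addrA lerDl -opprD oppr_ge0.
have ji1 : j = j.-1.+1 by lia.
rewrite addrC -lerBrDr sub0r ge_max !lerN2; apply/andP; split.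
  by apply: le_trans (IHt i.+1 j _ _); [exact: upsum_ge_left|lia..].
rewrite {1}ji1; apply: le_trans (IHt i j.-1 _ _); [|lia..].
by apply: upsum_ge_right; lia.
Qed.

(** Induction from the top: at an upper cover y the inductive bound cancels in [evolS], leaving
    e_(t+1)(y) at most e_t at every lower cover of y, one of which is (i, j). *)
Lemma upsum_evolutionS_le t i j : (i <= j < n)%N -> (t <= j - i)%N ->
  up (e t.+1) i j <= e t i j.
Proof.
move=> ijn; move: i j ijn; apply: upper_ind => i j ijn IHi IHj tji.
have step i' j' : (i' <= j' < n)%N -> (t < j' - i')%N ->
    up (e t.+1) i' j' <= e t i' j' ->
    e t.+1 i' j' <= e t i'.+1 j' /\ e t.+1 i' j' <= e t i' j'.-1.
  move=> ijn' tji' upe; rewrite (evolS E) //; set m := Num.max _ _.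
  have : - e t i'.+1 j' <= m by rewrite le_max lexx.
  have : - e t i' j'.-1 <= m by rewrite le_max lexx orbT.
  by move: upe; set u := up _ _ _; lra.
apply: upsum_le => // [i' ii'|jn|i0 jn].
- by rewrite ii'; apply: (step i' j _ _ _).1; [..|apply: IHi]; lia.
- by apply: (step i j.+1 _ _ _).2; [..|apply: IHj]; lia.
(* At the top both op-sums are the default 0. *)
- apply: le_trans (upsum_evolution_le _ tji) => //.
  by rewrite i0 /upsum ifF //; lia.
Qed.

Lemma readout_ge0 K : (forall i, (i < n)%N -> e 0%N i i <= K) ->
  forall i j, (i <= j < n)%N -> 0 <= readout Num.max K n e i j.
Proof.
move=> eK i j ijn; rewrite /readout; case: eqP => [->|ij].
  by rewrite subr_ge0 eK //; lia.
rewrite subr_ge0; have := @upsum_evolutionS_le (j - i).-1 i j ijn.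
have -> : (j - i).-1.+1 = (j - i)%N by lia.
by apply; lia.
Qed.

End Tropical.

(** * The subtraction-free expressions *)

(** Extends f to all pairs of naturals. The default is 0 for reals and [SFOne] for expressions,
    which agree under [geval]. *)
Definition entry (T : Type) (d : T) n (f : ivl n -> T) (i j : nat) : T :=
  if [pick x : ivl n | ((ends x).1 == i :> nat) && ((ends x).2 == j :> nat)]
    is Some x then f x else d.

Lemma ends_inj n (x y : ivl n) :
  (ends x).1 = (ends y).1 :> nat -> (ends x).2 = (ends y).2 :> nat -> x = y.
Proof. by move=> e1 e2; apply: ivl_inj; rewrite /lo /hi ?e1 ?e2. Qed.

Lemma entry_ends (T : Type) (d : T) n (f : ivl n -> T) x :
  entry d f (ends x).1 (ends x).2 = f x.
Proof.
rewrite /entry; case: pickP => [y /andP[/eqP e1 /eqP e2]|/(_ x)].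
  by rewrite (ends_inj e1 e2).
by rewrite !eqxx.
Qed.

Lemma ivl_exists n i j : (i <= j < n)%N ->
  exists x : ivl n, (ends x).1 = i :> nat /\ (ends x).2 = j :> nat.
Proof.
move=> ijn; have [ltin ltjn] : (i < n)%N /\ (j < n)%N by lia.
have ij : ((Ordinal ltin, Ordinal ltjn).1 <= (Ordinal ltin, Ordinal ltjn).2)%N.
  by case/andP: ijn.
by exists (Ivl ij).
Qed.

Lemma sum_entry (R : realType) n (p : ivl n -> R) i j :
  \sum_(x : ivl n | ((ends x).1 == i :> nat) && ((ends x).2 == j :> nat)) p x =
  entry 0 p i j.
Proof.
rewrite /entry; case: pickP => [x /andP[/eqP x1 /eqP x2]|no].
  apply: big_pred1 => y /=; apply/andP/eqP => [[/eqP y1 /eqP y2]|->].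
    by apply: ends_inj; rewrite ?x1 ?x2.
  by rewrite x1 x2 !eqxx.
by rewrite big_pred0.
Qed.

Lemma entry_out (R : realType) n (p : ivl n -> R) i j :
  (j < i)%N -> entry 0 p i j = 0.
Proof.
move=> ltji; rewrite /entry; case: pickP => // x /andP[/eqP x1 /eqP x2].
by have := lo_le_hi x; rewrite /lo /hi; lia.
Qed.

Lemma sum_lo (R : realType) n (p : ivl n -> R) i :
  \sum_(x : ivl n | (ends x).1 == i :> nat) p x =
  \sum_(i <= m < n) entry 0 p i m.
Proof.
rewrite (partition_big (fun x => (ends x).2) xpredT) //= big_geq_mkord.
rewrite [RHS]big_mkcond; apply: eq_bigr => m _ /=.
have -> : \sum_(x : ivl n | ((ends x).1 == i :> nat) && ((ends x).2 == m)) p x =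
  entry 0 p i m by rewrite -sum_entry.
by case: leqP => // mi; rewrite entry_out.
Qed.

Lemma sum_hi (R : realType) n (p : ivl n -> R) i : (i < n)%N ->
  \sum_(x : ivl n | (ends x).2 == i :> nat) p x =
  \sum_(0 <= m < i.+1) entry 0 p m i.
Proof.
move=> ltin; rewrite (partition_big (fun x => (ends x).1) xpredT) //= big_mkord.
rewrite (big_ord_widen_cond _ xpredT (fun m => entry 0 p m i) ltin) /=.
rewrite [RHS]big_mkcond; apply: eq_bigr => m _ /=.
have -> : \sum_(x : ivl n | ((ends x).2 == i :> nat) && ((ends x).1 == m)) p x =
  entry 0 p m i by rewrite -sum_entry; apply: eq_bigl => x; rewrite andbC.
by rewrite ltnS; case: leqP => // mi; rewrite entry_out.
Qed.

(** Common form of [tropeval] ([op] is max, K = 1) and of the logarithm of [sfeval] at positive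
    points ([op] is [lse], K = ln kappa). *)
Fixpoint geval (R : realType) (X : Type) (op : R -> R -> R) (K : R) (p : X -> R)
    (e : sfexpr X) : R :=
  match e with
  | SFVar x => p x
  | SFKappa => K
  | SFOne => 0
  | SFAdd e1 e2 => op (geval op K p e1) (geval op K p e2)
  | SFMul e1 e2 => geval op K p e1 + geval op K p e2
  | SFDiv e1 e2 => geval op K p e1 - geval op K p e2
  end.

Lemma tropevalE (R : realType) X (p : X -> R) e :
  tropeval p e = geval Num.max 1 p e.
Proof. by elim: e => //= e1 -> e2 ->. Qed.

Section Expressions.
Variable n : nat.
Local Notation expr := (sfexpr (ivl n)).

(* Recursion on n - (j - i), which drops by one from (i, j) to its upper covers. *)
Fixpoint from_top (F : nat -> nat -> expr -> expr) (m i j : nat) : expr :=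
  if m is m'.+1
  then F i j (upsum (SFOne : expr) (@SFAdd _) n (from_top F m') i j) else SFOne.

Definition fill (F : nat -> nat -> expr -> expr) (i j : nat) : expr :=
  from_top F (n - (j - i)) i j.

Lemma fillE F i j : (i <= j < n)%N ->
  fill F i j = F i j (upsum (SFOne : expr) (@SFAdd _) n (fill F) i j).
Proof.
move=> ijn; rewrite /fill; have -> : (n - (j - i) = (n - (j - i)).-1.+1)%N by lia.
move=> /=; congr (F i j _); apply: eq_upsum => [i' ii'|jn]; congr (from_top F _ _ _); lia.
Qed.

(** [SFDiv SFOne] is negation in logarithmic coordinates. *)
Fixpoint evolution_expr (t : nat) : nat -> nat -> expr :=
  if t is t'.+1 then
    fill (fun i j u =>
      SFDiv (SFDiv u (evolution_expr t' i j))
            (SFAdd (SFDiv SFOne (evolution_expr t' i.+1 j))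
                   (SFDiv SFOne (evolution_expr t' i j.-1))))
  else fill (fun i j u => SFMul (entry SFOne (@SFVar _) i j) u).

Definition LK_expr (x : ivl n) : expr :=
  let i := nat_of_ord (ends x).1 in let j := nat_of_ord (ends x).2 in
  if i == j then SFDiv SFKappa (evolution_expr 0 i i)
  else SFDiv (evolution_expr (j - i).-1 i j)
             (upsum (SFOne : expr) (@SFAdd _) n (evolution_expr (j - i)) i j).

Variables (R : realType) (op : R -> R -> R) (K : R).
Hypothesis opD : forall a b c, op (a + c) (b + c) = op a b + c.

Lemma geval_upsum p f i j :
  geval op K p (upsum (SFOne : expr) (@SFAdd _) n f i j) =
  upsum 0 op n (fun i j => geval op K p (f i j)) i j.
Proof. by rewrite /upsum; case: i => [|i]; case: ifP. Qed.

Lemma geval_evolution p : evolution op n (entry 0 p)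
  (fun t i j => geval op K p (evolution_expr t i j)).
Proof.
split=> [i j ijn|t i j ijn _] /=; rewrite fillE //= geval_upsum ?sub0r //.
by congr (_ + _); rewrite /entry; case: pickP.
Qed.

Lemma geval_LK_expr p x : geval op K p (LK_expr x) =
  readout op K n (fun t i j => geval op K p (evolution_expr t i j))
    (ends x).1 (ends x).2.
Proof.
by rewrite /LK_expr /readout; case: eqP => /= [<-//|_]; rewrite geval_upsum.
Qed.

Variables p q : ivl n -> R.
Hypothesis qE : forall x, q x = geval op K p (LK_expr x).

Lemma entry_LK_expr i j : (i <= j < n)%N -> entry 0 q i j =
  readout op K n (fun t i j => geval op K p (evolution_expr t i j)) i j.
Proof. by case/ivl_exists => x [<- <-]; rewrite entry_ends qE geval_LK_expr. Qed.

Lemma LK_exprK x : geval op K q (LK_expr x) = p x.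
Proof.
rewrite geval_LK_expr -(entry_ends 0 p x).
have := readoutK (geval_evolution p) (geval_evolution q) entry_LK_expr.
by apply; rewrite ltn_ord andbT; case: x.
Qed.

Lemma sum_hi_lo_LK_expr i : (i < n)%N ->
  \sum_(x : ivl n | (ends x).2 == i :> nat) p x +
  \sum_(x : ivl n | (ends x).1 == i :> nat) q x = K.
Proof.
move=> ltin; rewrite sum_lo sum_hi //.
apply: (col_row_readout opD (geval_evolution p) (geval_evolution q)) => //.
exact: entry_LK_expr.
Qed.

End Expressions.

(** By the involution, p and q may be exchanged in [sum_hi_lo_LK_expr]. *)
Lemma sum_lo_hi_LK_expr (R : realType) (op : R -> R -> R) (K : R) n
    (p q : ivl n -> R) i :
    (forall a b c, op (a + c) (b + c) = op a b + c) ->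
    (forall x, q x = geval op K p (LK_expr x)) -> (i < n)%N ->
  \sum_(x : ivl n | (ends x).1 == i :> nat) p x +
  \sum_(x : ivl n | (ends x).2 == i :> nat) q x = K.
Proof.
move=> opD qE ltin; rewrite addrC.
apply: (@sum_hi_lo_LK_expr n R op K opD q p) => // x.
by rewrite (LK_exprK qE).
Qed.

(** * The birational map *)

Definition lse (R : realType) (a b : R) : R := ln (expR a + expR b).

Lemma lseD (R : realType) (a b c : R) : lse (a + c) (b + c) = lse a b + c.
Proof.
rewrite /lse !expRD -mulrDl lnM ?expRK // posrE ?expR_gt0 //.
by rewrite addr_gt0 ?expR_gt0.
Qed.

(** Without subtraction every subexpression stays positive, so logarithms can be taken
    throughout. *)
Lemma sfevalE (R : realType) X (kappa : R) (p : X -> R) e :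
    0 < kappa -> (forall x, 0 < p x) ->
  sfeval kappa p e = expR (geval (@lse R) (ln kappa) (fun x => ln (p x)) e).
Proof.
move=> k0 p0; elim: e => /= [x||| e1 -> e2 ->| e1 -> e2 ->| e1 -> e2 ->].
- by rewrite lnK ?posrE.
- by rewrite lnK ?posrE.
- by rewrite expR0.
- by rewrite /lse lnK // posrE addr_gt0 ?expR_gt0.
- by rewrite expRD.
- by rewrite expRB.
Qed.

Section Birational.
Variables (R : realType) (n : nat) (kappa : R).
Hypothesis kappa_gt0 : 0 < kappa.
Variable p : {ffun ivl n -> R}.
Hypothesis p_gt0 : positive p.
Let q := birational_map (@LK_expr n) kappa p.

Lemma birational_LK_gt0 : positive q.
Proof. by move=> x; rewrite ffunE sfevalE ?expR_gt0. Qed.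

Lemma ln_birational_LK x :
  ln (q x) = geval (@lse R) (ln kappa) (fun x => ln (p x)) (LK_expr x).
Proof. by rewrite ffunE sfevalE ?expRK. Qed.

Lemma birational_LKK : birational_map (@LK_expr n) kappa q = p.
Proof.
apply/ffunP => x; rewrite ffunE sfevalE //; last exact: birational_LK_gt0.
by rewrite (LK_exprK ln_birational_LK) lnK // posrE.
Qed.

Lemma prod_lo_hi i : (i < n)%N ->
  (\prod_(x : ivl n | (ends x).1 == i :> nat) p x) *
  (\prod_(x : ivl n | (ends x).2 == i :> nat) q x) = kappa.
Proof.
move=> ltin; rewrite -[RHS]lnK ?posrE //.
rewrite -(sum_lo_hi_LK_expr (@lseD R) ln_birational_LK ltin) expRD !expR_sum.
by congr (_ * _); apply: eq_bigr => x _; rewrite lnK ?posrE ?birational_LK_gt0.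
Qed.

Lemma prod_hi_lo i : (i < n)%N ->
  (\prod_(x : ivl n | (ends x).2 == i :> nat) p x) *
  (\prod_(x : ivl n | (ends x).1 == i :> nat) q x) = kappa.
Proof.
move=> ltin; rewrite -[RHS]lnK ?posrE //.
rewrite -(sum_hi_lo_LK_expr (@lseD R) ln_birational_LK ltin) expRD !expR_sum.
by congr (_ * _); apply: eq_bigr => x _; rewrite lnK ?posrE ?birational_LK_gt0.
Qed.

Lemma prod_end_exp (F : ivl n -> R) (f : ivl n -> 'I_n) (w : nat -> nat) :
  \prod_x F x ^+ w (f x) =
  \prod_(i < n) (\prod_(x : ivl n | f x == i :> nat) F x) ^+ w i.
Proof.
rewrite (partition_big f xpredT) //=; apply: eq_bigr => i _.
rewrite -prodrXl; apply: eq_big => x; first by [].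
by move=> /eqP ->.
Qed.

(** Grouping p by left ends and q by right ends gives one factor kappa for each i. *)
Lemma prod_birational_LK : (\prod_x p x) * (\prod_x q x) = kappa ^+ n.
Proof.
have -> : \prod_x p x = \prod_(i < n) (\prod_(x : ivl n | (ends x).1 == i :> nat) p x).
  by rewrite (partition_big (fun x => (ends x).1) xpredT).
have -> : \prod_x q x = \prod_(i < n) (\prod_(x : ivl n | (ends x).2 == i :> nat) q x).
  by rewrite (partition_big (fun x => (ends x).2) xpredT).
rewrite -big_split /=; under eq_bigr do rewrite prod_lo_hi //.
by rewrite prodr_const card_ord.
Qed.

Lemma prod_exp_birational_LK :
  (\prod_x p x ^+ (lo x + hi x)) * (\prod_x q x ^+ (lo x + hi x)) =
  kappa ^+ (n * n.+1).
Proof.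
have lohiE (F : ivl n -> R) : \prod_x F x ^+ (lo x + hi x) =
    \prod_(i < n) (\prod_(x : ivl n | (ends x).1 == i :> nat) F x) ^+ i.+1 *
    \prod_(i < n) (\prod_(x : ivl n | (ends x).2 == i :> nat) F x) ^+ i.+1.
  rewrite -(prod_end_exp F (fun x => (ends x).1) S).
  rewrite -(prod_end_exp F (fun x => (ends x).2) S) -big_split /=.
  by apply: eq_bigr => x _; rewrite exprD.
(* Pairs left ends of p with right ends of q and conversely, so each i contributes kappa to the
   power 2 (i + 1). *)
rewrite !lohiE [X in _ * X]mulrC mulrACA -!big_split /=.
under eq_bigr do rewrite -!exprMn prod_lo_hi // prod_hi_lo // -expr2 -exprM.
rewrite prodrXr; congr (_ ^+ _); rewrite -(big_mkord xpredT (fun i => 2 * i.+1)%N).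
elim: (n) => [|m IHm]; first by rewrite big_geq.
by rewrite big_nat_recr //= IHm; lia.
Qed.

End Birational.

(** * Tropicalizations are piecewise linear *)

Section PiecewiseLinear.
Variables (R : realType) (X : finType).
Local Notation form := (affine_form R X).

Definition addf (l m : form) : form := ([ffun x => l.1 x + m.1 x], l.2 + m.2).
Definition subf (l m : form) : form := ([ffun x => l.1 x - m.1 x], l.2 - m.2).
Definition constf (c : R) : form := ([ffun=> 0], c).
Definition coordf (x : X) : form := ([ffun y => (y == x)%:R], 0).

Lemma aeval_addf l m p : aeval (addf l m) p = aeval l p + aeval m p.
Proof.
rewrite /aeval addrACA -big_split /=; congr (_ + _).
by apply: eq_bigr => x _; rewrite ffunE mulrDl.
Qed.

Lemma aeval_subf l m p : aeval (subf l m) p = aeval l p - aeval m p.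
Proof.
rewrite /aeval opprD addrACA -sumrB /=; congr (_ + _).
by apply: eq_bigr => x _; rewrite ffunE mulrBl.
Qed.

Lemma aeval_constf c p : aeval (constf c) p = c.
Proof. by rewrite /aeval big1 ?addr0 // => x _; rewrite ffunE mul0r. Qed.

Lemma aeval_coordf x p : aeval (coordf x) p = p x.
Proof.
rewrite /aeval add0r (bigD1 x) //= ffunE eqxx mul1r big1 ?addr0 // => y /negPf yx.
by rewrite ffunE yx mul0r.
Qed.

(** Each pair is a list of inequalities with the affine form valid where they hold. A max splits a
    cell by which argument is larger, and ties lie in both halves. *)
Fixpoint tropcells (e : sfexpr X) : seq (seq form * form) :=
  match e with
  | SFVar x => [:: ([::], coordf x)]
  | SFKappa => [:: ([::], constf 1)]
  | SFOne => [:: ([::], constf 0)]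
  | SFAdd e1 e2 =>
      [seq (subf a.2 b.2 :: a.1 ++ b.1, a.2) | a <- tropcells e1, b <- tropcells e2] ++
      [seq (subf b.2 a.2 :: a.1 ++ b.1, b.2) | a <- tropcells e1, b <- tropcells e2]
  | SFMul e1 e2 =>
      [seq (a.1 ++ b.1, addf a.2 b.2) | a <- tropcells e1, b <- tropcells e2]
  | SFDiv e1 e2 =>
      [seq (a.1 ++ b.1, subf a.2 b.2) | a <- tropcells e1, b <- tropcells e2]
  end.

Lemma polyhedron_cat (s t : seq form) p :
  polyhedron (s ++ t) p <-> polyhedron s p /\ polyhedron t p.
Proof.
split=> [st|[sp tp] h]; last by rewrite mem_cat => /orP[/sp|/tp].
by split=> h hs; apply: st; rewrite mem_cat hs ?orbT.
Qed.

Lemma polyhedron_cons (l : form) (s : seq form) p :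
  polyhedron (l :: s) p <-> 0 <= aeval l p /\ polyhedron s p.
Proof.
split=> [ls|[lp sp] h]; last by rewrite inE => /predU1P[->|/sp].
by split=> [|h hs]; apply: ls; rewrite inE ?eqxx // hs orbT.
Qed.

Lemma tropcells_agree e c p : c \in tropcells e -> polyhedron c.1 p ->
  tropeval p e = aeval c.2 p.
Proof.
elim: e c => [x c|c|c|e1 IH1 e2 IH2 c|e1 IH1 e2 IH2 c|e1 IH1 e2 IH2 c] /=.
- by rewrite inE => /eqP -> _; rewrite aeval_coordf.
- by rewrite inE => /eqP -> _; rewrite aeval_constf.
- by rewrite inE => /eqP -> _; rewrite aeval_constf.
- rewrite mem_cat => /orP[] /allpairsP[[a b] [/= ac bc ->]] /=;
    rewrite polyhedron_cons polyhedron_cat aeval_subf subr_ge0 => -[le_ab [ap bp]].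
  + by rewrite (IH1 a) // (IH2 b) // max_l.
  + by rewrite (IH1 a) // (IH2 b) // max_r.
- move=> /allpairsP[[a b] [/= ac bc ->]] /=; rewrite polyhedron_cat => -[ap bp].
  by rewrite (IH1 a) // (IH2 b) // aeval_addf.
- move=> /allpairsP[[a b] [/= ac bc ->]] /=; rewrite polyhedron_cat => -[ap bp].
  by rewrite (IH1 a) // (IH2 b) // aeval_subf.
Qed.

Lemma tropcells_cover e p : exists2 c, c \in tropcells e & polyhedron c.1 p.
Proof.
elim: e => [x|||e1 [a ac ap] e2 [b bc bp]|e1 [a ac ap] e2 [b bc bp]|
  e1 [a ac ap] e2 [b bc bp]] /=.
- by exists ([::], coordf x); rewrite ?inE.
- by exists ([::], constf 1); rewrite ?inE.
- by exists ([::], constf 0); rewrite ?inE.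
- have [le_ba|/ltW le_ab] := leP (aeval b.2 p) (aeval a.2 p).
  + exists (subf a.2 b.2 :: a.1 ++ b.1, a.2).
      by rewrite mem_cat; apply/orP; left; apply/allpairsP; exists (a, b).
    by rewrite polyhedron_cons polyhedron_cat aeval_subf subr_ge0.
  + exists (subf b.2 a.2 :: a.1 ++ b.1, b.2).
      by rewrite mem_cat; apply/orP; right; apply/allpairsP; exists (a, b).
    by rewrite polyhedron_cons polyhedron_cat aeval_subf subr_ge0.
- exists (a.1 ++ b.1, addf a.2 b.2); last by rewrite polyhedron_cat.
  by apply/allpairsP; exists (a, b).
- exists (a.1 ++ b.1, subf a.2 b.2); last by rewrite polyhedron_cat.
  by apply/allpairsP; exists (a, b).
Qed.

Lemma tropicalization_piecewise_linear (E : X -> sfexpr X) :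
  piecewise_linear (@tropicalization R X E).
Proof.
(* A common refinement: a cell of the map chooses one cell for every output coordinate. *)
pose K := {dffun forall y, 'I_(size (tropcells (E y)))}.
pose c0 : seq form * form := ([::], constf 0).
pose cell_at (k : K) y := nth c0 (tropcells (E y)) (k y).
exists #|K|, (fun i => flatten [seq (cell_at (enum_val i) y).1 | y <- enum X]),
  (fun i y => (cell_at (enum_val i) y).2); split=> [p|i p ip y].
  (* The boolean [all] in place of [polyhedron] lets [sigW] extract a witness. *)
  have idx y : {j : 'I_(size (tropcells (E y))) |
      all (fun h => 0 <= aeval h p) (nth c0 (tropcells (E y)) j).1}.
    apply: sigW; have [c cE cp] := tropcells_cover (E y) p.
    have ltc : (index c (tropcells (E y)) < size (tropcells (E y)))%N.
      by rewrite index_mem.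
    by exists (Ordinal ltc); rewrite /= nth_index //; apply/allP.
  exists (enum_rank ([ffun y => sval (idx y)] : K)) => h.
  rewrite enum_rankK => /flattenP[s /mapP[y _ ->]].
  by rewrite /cell_at ffunE => /(allP (svalP (idx y))).
rewrite ffunE; apply: tropcells_agree; first by rewrite mem_nth.
move=> h hy; apply: ip; apply/flattenP; exists (cell_at (enum_val i) y).1 => //.
by apply/mapP; exists y; rewrite ?mem_enum.
Qed.

End PiecewiseLinear.

(** * The tropical map on the chain polytope *)

Lemma ivl_leE n (x y : ivl n) : (x <= y)%O =
  ((ends y).1 <= (ends x).1)%N && ((ends x).2 <= (ends y).2)%N.
Proof. by rewrite /Order.le /= /ivl_le elements_subsetE. Qed.

Lemma sum_setD1_le (R : realType) (T : finType) (p : T -> R) (C : {set T}) x :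
  0 <= p x -> \sum_(y in C) p y <= p x + \sum_(y in C :\ x) p y.
Proof.
move=> px; have [xC|xC] := boolP (x \in C); first by rewrite -big_setD1.
suff -> : C :\ x = C by rewrite lerDr.
by apply/setP => y; rewrite !inE; case: eqP => // ->; rewrite (negbTE xC).
Qed.

Section ChainSums.
Variables (R : realType) (n : nat) (p : ivl n -> R) (e : nat -> nat -> nat -> R).
Hypothesis E : evolution Num.max n (entry 0 p) e.
Local Notation up := (upsum (0 : R) Num.max n).
Local Notation above i j C :=
  {in C, forall x : ivl n, ((ends x).1 <= i)%N && (j <= (ends x).2)%N}.

(** Moving repeatedly to an upper cover that attains the max builds the chain. *)
Lemma evolution0_chain i j : (i <= j < n)%N -> exists C : {set ivl n},
  [/\ chain C, above i j C & \sum_(x in C) p x = e 0%N i j].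
Proof.
move: i j; apply: upper_ind => i j ijn IHi IHj.
have [x0 [x01 x02]] := ivl_exists ijn.
suff [C [cC aC x0C sC]] : exists C : {set ivl n},
    [/\ chain C, above i j C, x0 \notin C & \sum_(x in C) p x = up (e 0%N) i j].
  exists (x0 |: C); split=> [x y|x|].
  - rewrite !inE => /predU1P[->|xC] /predU1P[->|yC]; last exact: cC.
    + exact: comparablexx.
    + by rewrite /Order.comparable !ivl_leE x01 x02 aC.
    + by rewrite /Order.comparable !ivl_leE x01 x02 aC ?orbT.
  - by rewrite !inE => /predU1P[->|/aC]; rewrite ?x01 ?x02 ?leqnn.
  - by rewrite big_setU1 //= sC (evol0 E) // -{2}x01 -{2}x02 entry_ends.
have left i' : i = i'.+1 -> up (e 0%N) i j = e 0%N i' j ->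
    exists C : {set ivl n},
    [/\ chain C, above i j C, x0 \notin C & \sum_(x in C) p x = up (e 0%N) i j].
  move=> ii' ->; have [C [cC aC sC]] := IHi i' ii'; exists C; split=> //.
    by move=> x /aC; lia.
  by apply/negP => /aC; rewrite x01 x02; lia.
have right : (j.+1 < n)%N -> up (e 0%N) i j = e 0%N i j.+1 ->
    exists C : {set ivl n},
    [/\ chain C, above i j C, x0 \notin C & \sum_(x in C) p x = up (e 0%N) i j].
  move=> jn ->; have [C [cC aC sC]] := IHj jn; exists C; split=> //.
    by move=> x /aC; lia.
  by apply/negP => /aC; rewrite x01 x02; lia.
move: left right; rewrite /upsum; case: (i) => [|i']; case: ltnP => jn left right.
- exact: right.
- by exists set0; split=> [x y|x||]; rewrite ?inE ?big_set0.
- have [h|/ltW h] := leP (e 0%N i' j) (e 0%N i'.+1 j.+1).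
    by rewrite max_r // in left right *; apply: right.
  by rewrite max_l // in left right *; apply: (left i').
- exact: (left i').
Qed.

Hypothesis p_ge0 : forall x, 0 <= p x.

(** Once (i, j) is removed, the rest of the chain lies above a single upper cover, where induction
    applies. *)
Lemma chain_sum_above i j (C : {set ivl n}) : (i <= j < n)%N ->
  chain C -> above i j C -> \sum_(x in C) p x <= e 0%N i j.
Proof.
move=> ijn; move: i j ijn C.
apply: (@upper_ind n (fun i j => forall C : {set ivl n}, chain C -> above i j C ->
  \sum_(x in C) p x <= e 0%N i j)) => i j ijn IHi IHj C cC aC.
have [x0 [x01 x02]] := ivl_exists ijn.
apply: le_trans (sum_setD1_le C (p_ge0 x0)) _.
rewrite (evol0 E) // -{1}x01 -{1}x02 entry_ends lerD2l.
set C' := C :\ x0.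
have cC' : chain C' by move=> x y /setD1P[_ xC] /setD1P[_ yC]; apply: cC.
have aC' : above i j C' by move=> x /setD1P[_ /aC].
have C'_neq x : x \in C' -> ~ ((ends x).1 = i :> nat /\ (ends x).2 = j :> nat).
  move=> /setD1P[/eqP xx0 _] [x1 x2]; apply: xx0.
  by apply: ends_inj; rewrite ?x01 ?x02.
have [/andP[i0 /forall_inP lti]|Nleft] :=
    boolP ((0 < i)%N && [forall x in C', ((ends x).1 < i)%N]).
  case: (i) (IHi i.-1) i0 lti aC' => // i' IH _ lti aC'.
  apply: le_trans (upsum_ge_left _ _ _ _); apply: IH => // x xC'.
  by have := lti x xC'; have := aC' x xC'; lia.
have [/andP[jn /forall_inP ltj]|Nright] :=
    boolP ((j.+1 < n)%N && [forall x in C', (j < (ends x).2)%N]).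
  apply: le_trans (upsum_ge_right _ _ jn); apply: IHj => // x xC'.
  by have := ltj x xC'; have := aC' x xC'; lia.
(* An empty C' satisfies both universal conditions, so (i, j) must be the top. *)
have [C'0|[z zC']] := set_0Vmem C'.
  rewrite C'0 big_set0.
  have FC' (P : pred (ivl n)) : [forall x in C', P x].
    by apply/forall_inP => x; rewrite C'0 inE.
  move: Nleft Nright; rewrite !FC' !andbT => i0 jn.
  have -> : i = 0%N by lia.
  by rewrite /upsum (negbTE jn).
(* If C' lies above neither upper cover, some x in it has left end i and some y has right end j.
   Both differ from (i, j), so they are incomparable. When i = 0 or j = n - 1, the bounds on the
   ends already force a member equal to (i, j). *)
exfalso.
have lastz x : x \in C' -> ((ends x).2 < n)%N by [].
have [i0|[x xC' xi]] : i = 0%N \/ exists2 x, x \in C' & (i <= (ends x).1)%N.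
  move: Nleft; rewrite negb_and => /orP[|/forall_inPn[x xC' xi]]; first by left; lia.
  by right; exists x; rewrite // leqNgt.
all: have [jn|[y yC' yj]] : j.+1 = n \/ exists2 y, y \in C' & ((ends y).2 <= j)%N
  by move: Nright; rewrite negb_and => /orP[|/forall_inPn[y yC' yj]];
    [left; lia|right; exists y; rewrite // leqNgt].
- by apply: (C'_neq z zC'); have := aC' z zC'; have := lastz z zC'; lia.
- by apply: (C'_neq y yC'); have := aC' y yC'; lia.
- by apply: (C'_neq x xC'); have := aC' x xC'; have := lastz x xC'; lia.
have := C'_neq x xC'; have := C'_neq y yC'.
have := aC' x xC'; have := aC' y yC'.
have := cC' x y xC' yC'; rewrite /Order.comparable !ivl_leE; lia.
Qed.

(** A nonempty chain has a least interval, found by minimal width, and all its members contain the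
    left end of that interval. *)
Lemma chain_sum_le K (C : {set ivl n}) : 0 <= K -> chain C ->
  (forall i, (i < n)%N -> e 0%N i i <= K) -> \sum_(x in C) p x <= K.
Proof.
move=> K0 cC eK; have [->|[z zC]] := set_0Vmem C; first by rewrite big_set0.
pose w (x : ivl n) := ((ends x).2 - (ends x).1)%N.
have [x xC xmin] := arg_minnP w zC.
apply: le_trans (eK (ends x).1 (ltn_ord _)).
apply: chain_sum_above => //; first by rewrite leqnn ltn_ord.
move=> y yC; have := xmin y yC; have := cC x y xC yC.
rewrite /w /Order.comparable !ivl_leE.
by have := lo_le_hi x; have := lo_le_hi y; rewrite /lo /hi; lia.
Qed.

End ChainSums.

Section TropicalLK.
Variables (R : realType) (n : nat).
Local Notation LKPL := (@tropicalization R (ivl n) (@LK_expr n)).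

Lemma maxD (a b c : R) : Num.max (a + c) (b + c) = Num.max a b + c.
Proof. by rewrite addr_maxl. Qed.

Lemma LKPLE p x : LKPL p x = geval Num.max 1 p (LK_expr x).
Proof. by rewrite ffunE tropevalE. Qed.

Lemma chain_polytope_ge0 (p : {ffun ivl n -> R}) x : chain_polytope p -> 0 <= p x.
Proof.
move=> pP; have /pP/andP[] : chain [set x]; last by rewrite big_set1.
by move=> y z; rewrite !inE => /eqP-> /eqP->; exact: comparablexx.
Qed.

Lemma LKPL_chain_polytope p : chain_polytope p -> chain_polytope (LKPL p).
Proof.
move=> pP; have p0 x := chain_polytope_ge0 x pP.
have E := geval_evolution Num.max 1 p.
have E' := geval_evolution Num.max 1 (LKPL p).
have e1 i : (i < n)%N -> geval Num.max 1 p (evolution_expr n 0 i i) <= 1.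
  move=> ltin; have [|C [cC _ <-]] := @evolution0_chain _ _ _ _ E i i; first by lia.
  by case/andP: (pP C cC).
have entry_ge0 i j : (i <= j < n)%N -> 0 <= entry 0 p i j.
  by case/ivl_exists => x [<- <-]; rewrite entry_ends.
have q0 x : 0 <= LKPL p x.
  rewrite LKPLE geval_LK_expr; apply: (readout_ge0 E) => //.
  by rewrite ltn_ord andbT; case: x.
move=> C cC; rewrite sumr_ge0 //=.
apply: (chain_sum_le E' q0) => // i ltin.
rewrite (evolution_readout_diag E E' (entry_LK_expr (LKPLE p))) // gerBl.
by apply: entry_ge0; rewrite leqnn.
Qed.

(** * Vertices of the chain polytope and antichains *)

Lemma sum_indicator (A : {set ivl n}) (P : pred (ivl n)) :
  \sum_(x | P x) indicator R A x = #|[set x in A | P x]|%:R.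
Proof.
rewrite -sum1_card natr_sum; under [RHS]eq_bigl do rewrite inE andbC.
by rewrite big_mkcondr; apply: eq_bigr => x _; rewrite ffunE; case: (x \in A).
Qed.

Lemma indicator_chain_polytope (A : {set ivl n}) :
  antichain A -> chain_polytope (indicator R A).
Proof.
move=> aA C cC; have -> : \sum_(x in C) indicator R A x = #|C :&: A|%:R.
  by rewrite sum_indicator; congr (_%:R); apply: eq_card => x; rewrite !inE andbC.
rewrite ler0n lern1 /=; apply/card_le1_eqP => x y /setIP[xC xA] /setIP[yC yA].
by case/orP: (cC x y xC yC) => [/aA|/aA] ->.
Qed.

Lemma geval_max_int (X : Type) (p : X -> R) e :
  (forall x, exists z : int, p x = z%:~R) ->
  exists z : int, geval Num.max 1 p e = z%:~R.
Proof.
move=> pZ; elim: e => //= [||e1 [a ->] e2 [b ->]|e1 [a ->] e2 [b ->]|e1 [a ->] e2 [b ->]].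
- by exists 1.
- by exists 0.
- by case: leP => _; [exists b|exists a].
- by exists (a + b); rewrite intrD.
- by exists (a - b); rewrite intrB.
Qed.

(** One-element chains force the values 0 and 1, and two comparable elements of value 1 would give a
    chain of sum 2. *)
Lemma chain_polytope_int (q : {ffun ivl n -> R}) : chain_polytope q ->
  (forall x, exists z : int, q x = z%:~R) ->
  exists2 B, antichain B & q = indicator R B.
Proof.
move=> qP qZ; have qE x : q x = (q x == 1)%:R.
  have q0 := chain_polytope_ge0 x qP.
  have /qP/andP[_] : chain [set x].
    by move=> y z; rewrite !inE => /eqP-> /eqP->; exact: comparablexx.
  rewrite big_set1; move: q0; have [z ->] := qZ x.
  rewrite (ler_int _ 0) (ler_int _ _ 1) => z0 z1.
  have [->|->] : z = 0 \/ z = 1 by lia.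
    by rewrite eq_sym oner_eq0.
  by rewrite eqxx.
exists [set x | q x == 1]; last first.
  by apply/ffunP => x; rewrite ffunE inE.
move=> x y; rewrite !inE => /eqP x1 /eqP y1 le_xy; apply/eqP/negPn/negP => neq_xy.
have /qP/andP[_] : chain [set x; y].
  move=> u v; rewrite !inE /Order.comparable.
  by move=> /orP[]/eqP-> /orP[]/eqP->; rewrite ?lexx ?le_xy ?orbT.
by rewrite big_setU1 ?inE //= big_set1 x1 y1; lra.
Qed.

(** The image is integral by [geval_max_int], hence an indicator. With K = 1 the row and column
    identities become counts: the members of A with left end i and of B with right end i number one
    in total, and likewise with the ends exchanged. *)
Lemma LKPL_indicator_antichain (A : {set ivl n}) : antichain A ->
  exists B : {set ivl n}, [/\ antichain B, LKPL (indicator R A) = indicator R B,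
    forall i, (i < n)%N ->
      [exists x in B, (ends x).2 == i :> nat] = ~~ [exists x in A, (ends x).1 == i :> nat] &
    forall i, (i < n)%N ->
      [exists x in B, (ends x).1 == i :> nat] = ~~ [exists x in A, (ends x).2 == i :> nat]].
Proof.
move=> aA; have [x|B aB qB] := chain_polytope_int
    (LKPL_chain_polytope (indicator_chain_polytope aA)).
  rewrite LKPLE; apply: geval_max_int => y.
  by exists (y \in A)%:Z; rewrite ffunE; case: (y \in A).
have existsE (C : {set ivl n}) (P : pred (ivl n)) :
    [exists x in C, P x] = (0 < #|[set x in C | P x]|)%N.
  rewrite card_gt0; apply/exists_inP/set0Pn => -[x].
    by move=> xC Px; exists x; rewrite inE xC.
  by rewrite inE => /andP[xC Px]; exists x.
have qE := LKPLE (indicator R A).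
exists B; split=> // i ltin; rewrite !existsE.
  have := sum_lo_hi_LK_expr maxD qE ltin; rewrite qB !sum_indicator -natrD.
  by move/eqP; rewrite (eqr_nat _ _ 1); lia.
have := sum_hi_lo_LK_expr maxD qE ltin; rewrite qB !sum_indicator -natrD.
by move/eqP; rewrite (eqr_nat _ _ 1); lia.
Qed.

End TropicalLK.

(** Sorting by left ends also sorts the right ends, as a failure would nest two intervals. *)
Lemma antichain_sorted n (B : {set ivl n}) : antichain B ->
  exists s : seq (ivl n),
    [/\ s =i B, sorted ltn (map (@lo n) s) & sorted ltn (map (@hi n) s)].
Proof.
move=> aB; exists (sort (relpre (@lo n) leq) (enum B)); set s := sort _ _.
have sB : s =i B by move=> x; rewrite mem_sort mem_enum.
have slo : sorted ltn (map (@lo n) s).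
  rewrite ltn_sorted_uniq_leq map_inj_in_uniq ?sort_uniq ?enum_uniq /=.
    by rewrite sorted_map sort_sorted // => x y; exact: leq_total.
  by move=> x y; rewrite !sB; exact: antichain_lo_inj.
split=> //; move: slo; rewrite !sorted_map.
apply: (@sub_in_sorted _ (mem B)); last by apply/allP => x; rewrite sB.
move=> x y xB yB /= lo_xy; rewrite ltnNge; apply/negP => hi_yx.
have /(aB _ _ yB xB) yx : (y <= x)%O.
  by rewrite ivl_leE; move: lo_xy hi_yx; rewrite /lo /hi; lia.
by rewrite yx ltnn in lo_xy.
Qed.

(** An antichain is recovered by zipping its increasing left ends with its increasing right ends,
    and strictly sorted lists are determined by their members. *)
Lemma LK_unique n (A B : {set ivl n}) : antichain B ->
    (forall i, (i < n)%N ->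
      [exists x in B, (ends x).2 == i :> nat] = ~~ [exists x in A, (ends x).1 == i :> nat]) ->
    (forall i, (i < n)%N ->
      [exists x in B, (ends x).1 == i :> nat] = ~~ [exists x in A, (ends x).2 == i :> nat]) ->
  LK A = B.
Proof.
move=> aB hiB loB; have [s [sB slo shi]] := antichain_sorted aB.
have memE (f g : ivl n -> nat) :
    (forall x, 0 < f x <= n)%N ->
    (forall i, (i < n)%N ->
      [exists x in B, f x == i.+1] = ~~ [exists x in A, g x == i.+1]) ->
    sorted ltn (map f s) ->
    [seq k <- iota 1 n | k \notin [seq g x | x in A]] = map f s.
  move=> f_bounds fg sf; apply: (irr_sorted_eq ltn_trans ltnn) => //.
    by apply: sorted_filter; [exact: ltn_trans | exact: iota_ltn_sorted].
  move=> k; rewrite mem_filter mem_iota add1n ltnS.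
  have mapE (C : {set ivl n}) (h : ivl n -> nat) :
      (k \in [seq h x | x in C]) = [exists x in C, h x == k].
    apply/mapP/exists_inP => -[x xC kE].
      by exists x; rewrite ?kE // -mem_enum.
    by exists x; rewrite ?mem_enum ?(eqP kE).
  have -> : (k \in map f s) = (k \in [seq f x | x in B]).
    by apply: eq_mem_map => x; rewrite mem_enum sB.
  (* End points are successors i + 1, so the hypotheses on A and B say nothing at k = 0, where both
     sides are false. *)
  case: k mapE => [|k] mapE; last first.
    have [ltkn|lenk] := ltnP k n; first by rewrite /= andbT !mapE fg.
    rewrite !andbF; apply/esym/mapP => -[x _ kE].
    by have := f_bounds x; rewrite -kE; lia.
  rewrite andbF; apply/esym/mapP => -[x _ kE].
  by have := f_bounds x; rewrite -kE.
apply/setP => x; rewrite inE /new_los /new_his.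
rewrite (memE (@lo n) (@hi n)) ?(memE (@hi n) (@lo n)) //.
- by rewrite zip_map mem_map ?sB // => y z [yz1 yz2]; apply: ivl_inj; rewrite /lo /hi ?yz1 ?yz2.
- exact: hi_bounds.
- exact: lo_bounds.
Qed.

Lemma LKPL_indicator (R : realType) n (A : {set ivl n}) : antichain A ->
  @tropicalization R (ivl n) (@LK_expr n) (indicator R A) = indicator R (LK A).
Proof.
move=> aA; have [B [aB -> hiB loB]] := LKPL_indicator_antichain R aA.
by rewrite (LK_unique aB hiB loB).
Qed.

Theorem theorem1p1 (R : realType) (n : nat) (n_ge1 : (1 <= n)%N) :
  exists E : ivl n -> sfexpr (ivl n),
    (forall kappa : R, 0 < kappa ->
       let LKB := birational_map E kappa in
       [/\ forall p : {ffun ivl n -> R}, positive p -> positive (LKB p),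
           forall p : {ffun ivl n -> R}, positive p -> LKB (LKB p) = p,
           forall p : {ffun ivl n -> R}, positive p ->
             (\prod_(x : ivl n) p x) * (\prod_(x : ivl n) LKB p x)
               = kappa ^+ n
         & forall p : {ffun ivl n -> R}, positive p ->
             (\prod_(x : ivl n) p x ^+ (lo x + hi x)) *
             (\prod_(x : ivl n) LKB p x ^+ (lo x + hi x))
               = kappa ^+ (n * n.+1)]) /\
    (let LKPL := @tropicalization R (ivl n) E in
     [/\ piecewise_linear LKPL,
         forall p : {ffun ivl n -> R},
           chain_polytope p -> chain_polytope (LKPL p)
       & forall A : {set ivl n}, antichain A ->
           LKPL (indicator R A) = indicator R (LK A)]).
Proof.
exists (@LK_expr n); split=> [kappa kappa_gt0 LKB|LKPL]; split.
- by move=> p p_gt0; apply: birational_LK_gt0.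
- by move=> p p_gt0; apply: birational_LKK.
- by move=> p p_gt0; apply: prod_birational_LK.
- by move=> p p_gt0; apply: prod_exp_birational_LK.
- exact: tropicalization_piecewise_linear.
- exact: LKPL_chain_polytope.
- exact: LKPL_indicator.
Qed.
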